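(* Let $0\le\vartheta_1<\vartheta_2$ be real numbers. The set $\mathscr{K}_s([\vartheta_1,\vartheta_2])$ is dense in $\mathscr{K}([\vartheta_1,\vartheta_2])$ for the graph topology; that is, for every $f\in\mathscr{K}([\vartheta_1,\vartheta_2])$ and every $\varepsilon>0$ there exists $f_{\mathrm{app}}\in\mathscr{K}_s([\vartheta_1,\vartheta_2])$ such that $\|f-f_{\mathrm{app}}\|_{\mathscr{A}}\le\varepsilon$.
   Context: $\mathscr{K}([\vartheta_1,\vartheta_2])$ is the set of functions that vanish outside $[\vartheta_1,\vartheta_2]$ and equal on $[\vartheta_1,\vartheta_2]$ a finite sum $\sum_{i,j\geq 0}c_{ij}t^je^{\lambda_i t}$ with $c_{ij},\lambda_i\in\mathbb{C}$. $\mathscr{K}_s([\vartheta_1,\vartheta_2])$ is the subset of those with $\mathrm{Re}\,\lambda_i<0$ for all $i$. For $f\in\mathscr{L}_1(\mathbb{R}_+)$, $\|f\|_{\mathscr{A}}=\|f\|_{\mathscr{L}_1}=\int_0^\infty|f(t)|\,dt$. On these BIBO-stable systems the graph topology coincides with the topology of the norm $\|\cdot\|_{\mathscr{A}}$. *)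

(* Defs.v *)
From HB Require Import structures.
From mathcomp Require Import all_boot all_order all_algebra.
From mathcomp Require Import all_classical all_reals all_analysis.
From mathcomp Require Export complex.

Set Implicit Arguments.
Unset Strict Implicit.
Unset Printing Implicit Defensive.

Import Order.TTheory GRing.Theory Num.Theory.
Local Open Scope classical_set_scope.
Local Open Scope ring_scope.
Local Open Scope complex_scope.

Definition cexp (R : realType) (z : R[i]) : R[i] :=
  (expR (complex.Re z) * cos (complex.Im z)) +i*
  (expR (complex.Re z) * sin (complex.Im z)).

(* \sum_(i, j) c_ij t^j e^(lambda_i t), with finitely many i < m and j < n;
   m = 0 gives the empty sum. *)
Definition exp_poly (R : realType) (m n : nat) (c : 'I_m -> 'I_n -> R[i])
    (lambda : 'I_m -> R[i]) (t : R) : R[i] :=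
  \sum_(i < m) \sum_(j < n) c i j * t%:C ^+ j * cexp (lambda i * t%:C).

Definition spaceK (R : realType) (th1 th2 : R) : set (R -> R[i]) :=
  [set f | (forall t, t \notin `[th1, th2] -> f t = 0) /\
    exists (m n : nat) (c : 'I_m -> 'I_n -> R[i]) (lambda : 'I_m -> R[i]),
      forall t, t \in `[th1, th2] -> f t = exp_poly c lambda t].

Definition spaceKs (R : realType) (th1 th2 : R) : set (R -> R[i]) :=
  [set f | (forall t, t \notin `[th1, th2] -> f t = 0) /\
    exists (m n : nat) (c : 'I_m -> 'I_n -> R[i]) (lambda : 'I_m -> R[i]),
      (forall i, complex.Re (lambda i) < 0) /\
      forall t, t \in `[th1, th2] -> f t = exp_poly c lambda t].

(* The L_1(R_+) norm, extended-real valued so that it is defined for every f;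
   only the restriction of f to [0, +oo[ matters. *)
Definition normA (R : realType) (f : R -> R[i]) : \bar R :=
  (\int[@lebesgue_measure R]_(t in `[0%R, +oo[)
     (ComplexField.Normc.normc (f t))%:E)%E.

(* Main.v *)
(* If N exceeds every Re lambda_i, then f t = e^(N t) g t on [th1, th2], where g
   is an exponential polynomial whose exponents lambda_i - N have negative real
   part.  Replacing e^(N t) by a Taylor polynomial in t keeps these exponents,
   and the error tends to 0 uniformly on [0, th2]. *)
Require Import Defs.
From HB Require Import structures.
From mathcomp Require Import all_boot all_order all_algebra.
From mathcomp Require Import all_classical all_reals all_analysis.
From mathcomp Require Import ring.

Import Order.TTheory GRing.Theory Num.Theory.
Local Open Scope classical_set_scope.
Local Open Scope ring_scope.

Set Implicit Arguments.
Unset Strict Implicit.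
Unset Printing Implicit Defensive.

Import ComplexField.Normc.
Local Open Scope complex_scope.

Lemma normc_real (R : rcfType) (x : R) : 0 <= x -> normc x%:C = x.
Proof. by move=> x0 /=; rewrite [0 ^+ 2]expr0n addr0 sqrtr_sqr ger0_norm. Qed.

Lemma normc_ge0 (R : rcfType) (z : R[i]) : 0 <= normc z.
Proof. by case: z => a b; exact: sqrtr_ge0. Qed.

Lemma normcX (R : rcfType) (z : R[i]) n : normc (z ^+ n) = normc z ^+ n.
Proof.
elim: n => [|n IHn]; first by rewrite !expr0 normc1.
by rewrite !exprS normcM IHn.
Qed.

Lemma normc_sum (R : rcfType) (I : finType) (F : I -> R[i]) :
  normc (\sum_i F i) <= \sum_i normc (F i).
Proof.
apply: (big_ind2 (fun z r => normc z <= r)) => [|z1 r1 z2 r2 h1 h2|//].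
  by rewrite normc0.
by apply: le_trans (lerD h1 h2); exact: le_normcD.
Qed.

Lemma cexpD (R : realType) (z w : R[i]) : cexp (z + w) = cexp z * cexp w.
Proof.
case: z w => [a b] [c d]; apply/eqP; rewrite eq_complex /=.
apply/andP; split; apply/eqP; rewrite expRD ?cosD ?sinD; by ring.
Qed.

Lemma cexp_real (R : realType) (x : R) : cexp x%:C = (expR x)%:C.
Proof. by rewrite /cexp /= cos0 sin0 mulr1 mulr0. Qed.

Lemma normc_cexp (R : realType) (z : R[i]) :
  normc (cexp z) = expR (complex.Re z).
Proof.
rewrite /= !exprMn -mulrDr cos2Dsin2 mulr1 sqrtr_sqr ger0_norm//.
Qed.

Lemma exp_poly_shift (R : realType) m n (c : 'I_m -> 'I_n -> R[i])
    (lambda : 'I_m -> R[i]) (N t : R) :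
  exp_poly c lambda t =
  (expR (N * t))%:C * exp_poly c (fun i => lambda i - N%:C) t.
Proof.
rewrite /exp_poly mulr_sumr; apply: eq_bigr => i _.
rewrite mulr_sumr; apply: eq_bigr => j _.
rewrite mulrCA -cexp_real -cexpD; congr (_ * cexp _).
by rewrite mulrBl rmorphM/= addrC subrK.
Qed.

(** For each [i] the sum over [j] is itself a polynomial in [t], so the factor [p] is absorbed into
    the coefficients. The exponents [lambda] are untouched, which is what keeps the approximant in
    [spaceKs]. *)
Lemma horner_exp_poly (R : realType) m n (c : 'I_m -> 'I_n -> R[i])
    (lambda : 'I_m -> R[i]) (p : {poly R[i]}) :
  exists n' (c' : 'I_m -> 'I_n' -> R[i]), forall t,
    p.[t%:C] * exp_poly c lambda t = exp_poly c' lambda t.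
Proof.
pose q i := p * \sum_(j < n) (c i j)%:P * 'X^j.
(* The number of coefficients must not depend on [i], hence the maximum; coefficients of [q i]
   beyond its own size are 0. *)
exists (\max_(i < m) size (q i)), (fun i j => (q i)`_j) => t.
rewrite /exp_poly mulr_sumr; apply: eq_bigr => i _.
rewrite -!mulr_suml mulrA; congr (_ * _).
rewrite -(horner_coef_wide _ (leq_bigmax i)) hornerM; congr (_ * _).
rewrite horner_sum; apply: eq_bigr => j _.
by rewrite hornerM hornerC hornerXn.
Qed.

Lemma exp_poly_bounded (R : realType) m n (c : 'I_m -> 'I_n -> R[i])
    (lambda : 'I_m -> R[i]) (T : R) :
  exists2 B : R, 0 <= B &
    forall t, 0 <= t <= T -> normc (exp_poly c lambda t) <= B.
Proof.
(* A termwise bound, with absolute values so that it is nonnegative and increasing in [t] whatever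
   the signs of [T] and of the real parts. *)
exists (\sum_(i < m) \sum_(j < n)
  normc (c i j) * `|T| ^+ j * expR (`|complex.Re (lambda i)| * `|T|)).
  apply: sumr_ge0 => i _; apply: sumr_ge0 => j _.
  by rewrite !mulr_ge0 ?exprn_ge0 ?expR_ge0 ?normc_ge0.
move=> t /andP[t0 tT]; have tT' : t <= `|T| by rewrite (le_trans tT) ?ler_norm.
apply: le_trans (normc_sum _) _; apply: ler_sum => i _.
apply: le_trans (normc_sum _) _; apply: ler_sum => j _.
rewrite !normcM normcX normc_real// normc_cexp.
rewrite ler_pM ?mulr_ge0 ?normc_ge0 ?exprn_ge0 ?expR_ge0//.
  by rewrite ler_wpM2l ?normc_ge0// lerXn2r ?nnegrE.
rewrite ler_expR; case: (lambda i) => a b /=; rewrite mulr0 subr0.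
by rewrite (le_trans (ler_norm _))// normrM ler_pM// ger0_norm.
Qed.

(** The rest is the sum of [x ^+ k / k!] over [k >= K], whose terms are nonnegative and
    nondecreasing in [x >= 0]. A bound at the right endpoint is therefore uniform on the whole
    interval. *)
Lemma expR_taylor_rest_le (R : realType) (K : nat) (x y : R) : 0 <= x <= y ->
  0 <= expR x - series (exp_coeff x) K <= expR y - series (exp_coeff y) K.
Proof.
move=> /andP[x0 xy].
have cvgE (z : R) : series (exp_coeff z) n - series (exp_coeff z) K @[n --> \oo]
    --> expR z - series (exp_coeff z) K.
  by apply: cvgB; [exact: is_cvg_series_exp_coeff|exact: cvg_cst].
have subE (z : R) n : (K <= n)%N ->
    series (exp_coeff z) n - series (exp_coeff z) K =
    \sum_(K <= k < n) exp_coeff z k.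
  by move=> Kn; rewrite sub_series_geq.
apply/andP; split.
  rewrite -(cvg_lim _ (cvgE x))//; apply: limr_ge; first exact: cvgP (cvgE x).
  near=> n; rewrite subE; last by near: n; exact: nbhs_infty_ge.
  by apply: sumr_ge0 => k _; exact: exp_coeff_ge0.
apply: (ler_cvg_to (cvgE x) (cvgE y)).
near=> n; rewrite !subE; try by near: n; exact: nbhs_infty_ge.
apply: ler_sum => k _; rewrite /exp_coeff/= ler_wpM2r ?invr_ge0//.
by rewrite lerXn2r// nnegrE (le_trans x0).
Unshelve. all: by end_near. Qed.

(* The integral of a nonnegative function is a supremum over simple functions,
   so this domination needs no measurability of [f]. *)
Lemma ge0_integral_le_cst d (T : measurableType d) (R : realType)
    (mu : {measure set T -> \bar R}) (D A : set T) (f : T -> \bar R) (M : R) :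
  measurable A -> 0 <= M -> (forall x, D x -> (0 <= f x)%E) ->
  (forall x, A x -> (f x <= M%:E)%E) -> (forall x, ~ A x -> f x = 0%E) ->
  (\int[mu]_(x in D) f x <= M%:E * mu A)%E.
Proof.
move=> mA M0 f0 fM fA; rewrite -integral_cst//.
rewrite !ge0_integralE//; apply: le_ereal_sup => _ [h hf <-]; exists h => //= x.
apply: le_trans (hf x) _; rewrite /patch.
case: ifPn => [/set_mem Dx|_]; case: ifPn => [/set_mem Ax|nAx] //.
- exact: fM.
- by rewrite fA// => /mem_set Ax; rewrite Ax in nAx.
Qed.

Theorem corollary2 (R : realType) (th1 th2 : R)
    (hth1 : 0 <= th1) (hth : th1 < th2) :
  forall f : R -> complex R, spaceK th1 th2 f ->
  forall eps : R, 0 < eps ->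
  exists f_app : R -> complex R,
    spaceKs th1 th2 f_app /\
    (normA (fun t => (f t - f_app t)%R) <= eps%:E)%E.
Proof.
move=> f [f0 [m [n [c [lambda fE]]]]] eps eps0.
(* The summand 1 makes [N] strictly larger than every real part; the absolute values also give
   [0 <= N], so that [N * t] is nonnegative and nondecreasing for [t >= 0]. *)
pose N : R := 1 + \sum_i `|complex.Re (lambda i)|.
have N0 : 0 <= N by rewrite addr_ge0// sumr_ge0.
pose mu i := lambda i - N%:C.
have Remu i : complex.Re (mu i) < 0.
  rewrite /mu; have : complex.Re (lambda i) < N.
    rewrite (le_lt_trans (ler_norm _))// /N (bigD1 i)//=.
    by rewrite addrCA ltrDl ltr_pwDl// sumr_ge0.
  by case: (lambda i) => a b /= aN; rewrite subr_lt0.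
have [B B0 gB] := exp_poly_bounded c mu th2.
pose S K (x : R) := series (exp_coeff x) K.
(* A pointwise error of [eps / (th2 - th1)] integrates to [eps]. Dividing by [B + 1] rather than [B]
   covers the case [B = 0]. *)
pose delta : R := eps / (th2 - th1) / (B + 1).
have B1 : 0 < B + 1 by rewrite ltr_wpDl.
have th0 : 0 < th2 - th1 by rewrite subr_gt0.
have delta0 : 0 < delta by rewrite !divr_gt0.
(* Convergence of the exponential series at the single point [N * th2] suffices, by monotonicity of
   the rest. *)
have [K SK] : exists K, expR (N * th2) - S K (N * th2) <= delta.
  have /cvgrPdist_le /(_ _ delta0) [K _ KS] :=
    @is_cvg_series_exp_coeff R (N * th2).
  by exists K; apply: le_trans (ler_norm _) (KS K _) => /=.
pose p : {poly R[i]} := \poly_(k < K) (N ^+ k / k`!%:R)%:C.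
have pE t : p.[t%:C] = (S K (N * t))%:C.
  rewrite horner_poly /S /series/= big_mkord rmorph_sum; apply: eq_bigr => k _.
  by rewrite -(rmorphXn (real_complex R)) -rmorphM /exp_coeff/= exprMn mulrAC.
have [n' [c' pgE]] := @horner_exp_poly R m n c mu p.
exists (fun t => if t \in `[th1, th2] then exp_poly c' mu t else 0).
split.
  split; first by move=> t /negPf ->.
  by exists m, n', c', mu; split=> // t ->.
set h := fun t => _.
have h0 t : t \notin `[th1, th2] -> h t = 0.
  by move=> tn; rewrite /h f0// (negPf tn) subr0.
(* Here [h t] is the Taylor rest at [N * t] times the shifted exponential polynomial, hence of
   modulus at most [delta * B]. *)
have hle t : t \in `[th1, th2] -> normc (h t) <= eps / (th2 - th1).
  move=> tin; have /andP[t1 t2] : th1 <= t <= th2 by rewrite in_itv in tin.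
  have t0 : 0 <= t := le_trans hth1 t1.
  rewrite /h tin fE// (@exp_poly_shift _ _ _ _ _ N) -pgE pE -mulrBl -rmorphB/=.
  have /andP[r0 r1] : 0 <= expR (N * t) - S K (N * t) <=
      expR (N * th2) - S K (N * th2).
    by apply: expR_taylor_rest_le; rewrite mulr_ge0//= ler_wpM2l.
  rewrite normcM normc_real//.
  have t02 : 0 <= t <= th2 by rewrite t0.
  apply: le_trans (ler_pM r0 (normc_ge0 _) (le_trans r1 SK) (gB t t02)) _.
  rewrite /delta mulrAC ler_pdivrMr// ler_pM2l ?divr_gt0//.
  by rewrite lerDl.
apply: (@le_trans _ _ ((eps / (th2 - th1))%:E *
    @lebesgue_measure R `[th1, th2]%classic)%E).
  apply: ge0_integral_le_cst => //.
  - by rewrite divr_ge0// ltW.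
  - by move=> t _; rewrite lee_fin normc_ge0.
  - by move=> t /negP tn; rewrite h0// normc0.
rewrite lebesgue_measure_itv/= lte_fin hth -EFinB -EFinM lee_fin.
by rewrite divfK// gt_eqF.
Qed.
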